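(* Let $G(V,E)$, $V=\{1,\dots,n\}$, be a strongly connected directed graph. Let $(A_1,\dots,A_n)$ be the attractor of the graph-directed iterated function system $\mathcal{S}=(G(V,E),(S_e)_{e\in E})$ in $\mathbb{R}^d$, where $S_e$ is a bi-Lipschitz map for each $e\in E$, and let $(B_1,\dots,B_n)$ be the attractor of another graph-directed iterated function system $\mathcal{T}=(G(V,E),(f_e)_{e\in E})$ in $\mathbb{R}^d$ (on the same graph), where $f_e$ is a bi-Lipschitz map for each $e\in E$. Suppose that both $\mathcal{S}$ and $\mathcal{T}$ satisfy the strong separation condition and that $\mathcal{S}$ satisfies the bounded distortion property. Assume further that, for every finite admissible path $w$, the corresponding composed maps $S_w$ and $f_w$ satisfy $$\operatorname{Lip}^-(S_w)=\operatorname{Lip}^-(f_w)\quad\text{and}\quad\operatorname{Lip}^+(S_w)=\operatorname{Lip}^+(f_w).$$ Then $A_i$ and $B_i$ are bi-Lipschitz equivalent for each $i\in V$.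
   Context: A graph-directed iterated function system (GDIFS) in $\mathbb{R}^d$ is a pair $\mathcal{S}=(G(V,E),(S_e)_{e\in E})$, where $G(V,E)$ is a directed graph with vertex set $V=\{1,\dots,n\}$ and finite set $E$ of directed edges (several edges between the same vertices and loops are allowed), such that every vertex has at least one edge starting from it, and each $S_e:\mathbb{R}^d\to\mathbb{R}^d$ is a contraction (Lipschitz constant $<1$). For $i,k\in V$, $E_{i,k}$ denotes the set of edges from $i$ to $k$. The attractor of $\mathcal{S}$ is the unique $n$-tuple $(A_1,\dots,A_n)$ of nonempty compact subsets of $\mathbb{R}^d$ such that $A_i=\bigcup_{k=1}^n\bigcup_{e\in E_{i,k}}S_e(A_k)$ for each $i\in V$. The graph (and the GDIFS) is strongly connected if for all $i,j\in V$ there is a directed path from $i$ to $j$. A finite admissible path is a finite directed path $w=(e_1,\dots,e_p)$, $p\ge1$, in $G$ (each $e_{m+1}$ starts at the vertex where $e_m$ ends), and $S_w:=S_{e_1}\circ\cdots\circ S_{e_p}$, $f_w:=f_{e_1}\circ\cdots\circ f_{e_p}$. For $f:\mathbb{R}^d\to\mathbb{R}^d$, $\operatorname{Lip}^+(f)=\sup_{x\ne y}\frac{\|f(x)-f(y)\|}{\|x-y\|}$ and $\operatorname{Lip}^-(f)=\inf_{x\ne y}\frac{\|f(x)-f(y)\|}{\|x-y\|}$ (Euclidean norm); $f$ is bi-Lipschitz if $0<\operatorname{Lip}^-(f)\le\operatorname{Lip}^+(f)<\infty$. Two sets $A,B\subset\mathbb{R}^d$ are bi-Lipschitz equivalent if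 there are a bijection $\Phi:A\to B$ and a constant $C\ge1$ with $C^{-1}\|x-y\|\le\|\Phi(x)-\Phi(y)\|\le C\|x-y\|$ for all $x,y\in A$. $\mathcal{S}$ satisfies the strong separation condition (SSC) if, for each $i\in V$, the sets $S_e(A_k)$, where $k\in V$ and $e\in E_{i,k}$, are pairwise disjoint. $\mathcal{S}$ satisfies the bounded distortion property (BDP) if there exists $K>0$ such that $\operatorname{Lip}^+(S_w)\le K\operatorname{Lip}^-(S_w)$ for every finite admissible path $w$. *)

(* Defs.v *)
From HB Require Import structures.
From mathcomp Require Import all_boot all_order all_algebra.
From mathcomp Require Import all_classical all_reals all_analysis.
Set Implicit Arguments.
Unset Strict Implicit.
Unset Printing Implicit Defensive.
Import Order.TTheory GRing.Theory Num.Theory.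
Import numFieldNormedType.Exports.
Local Open Scope classical_set_scope.
Local Open Scope ring_scope.

(* The library's norm on 'rV[R]_d is the sup norm; it induces the same topology
   as the Euclidean norm, so that [compact] below has its usual meaning. *)
Definition enorm (R : realType) (d : nat) (x : 'rV[R]_d) : R :=
  Num.sqrt (\sum_(i < d) x ord0 i ^+ 2).

Definition lip_ratios (R : realType) (d : nat) (f : 'rV[R]_d -> 'rV[R]_d) :
    set (\bar R) :=
  [set r | exists x y : 'rV[R]_d,
     x <> y /\ r = (enorm (f x - f y) / enorm (x - y))%:E].

Definition LipP (R : realType) (d : nat) (f : 'rV[R]_d -> 'rV[R]_d) : \bar R :=
  ereal_sup (lip_ratios f).

Definition LipM (R : realType) (d : nat) (f : 'rV[R]_d -> 'rV[R]_d) : \bar R :=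
  ereal_inf (lip_ratios f).

Definition bi_lipschitz (R : realType) (d : nat)
    (f : 'rV[R]_d -> 'rV[R]_d) : Prop :=
  [/\ (0 < LipM f)%E, (LipM f <= LipP f)%E & (LipP f < +oo)%E].

Definition bi_lipschitz_equivalent (R : realType) (d : nat)
    (A B : set 'rV[R]_d) : Prop :=
  exists (Phi : 'rV[R]_d -> 'rV[R]_d) (C : R),
    [/\ set_bij A B Phi, 1 <= C &
        forall x y, A x -> A y ->
          C^-1 * enorm (x - y) <= enorm (Phi x - Phi y) <= C * enorm (x - y)].

(* Directed multigraphs, loops allowed, with vertex set 'I_n. *)
Record digraph (n : nat) := Digraph {
  edge : finType;
  src : edge -> 'I_n;
  tgt : edge -> 'I_n }.

Definition edges_between (n : nat) (G : digraph n) (i k : 'I_n) :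
    set (edge G) :=
  [set e | src e = i /\ tgt e = k].

Definition has_edge (n : nat) (G : digraph n) : rel 'I_n :=
  fun i k => [exists e : edge G, (src e == i) && (tgt e == k)].

Definition strongly_connected (n : nat) (G : digraph n) : Prop :=
  forall i j : 'I_n, connect (has_edge G) i j.

Definition admissible (n : nat) (G : digraph n) (w : seq (edge G)) : bool :=
  (w != [::]) && sorted (fun e e' : edge G => tgt e == src e') w.

Record gdifs (R : realType) (d n : nat) (G : digraph n) := Gdifs {
  gmap :> edge G -> 'rV[R]_d -> 'rV[R]_d;
  gdifs_out : forall i : 'I_n, exists e : edge G, src e = i;
  gdifs_contraction : forall e : edge G, (LipP (gmap e) < 1)%E }.

Definition gdifs_path (R : realType) (d n : nat) (G : digraph n)
    (S : gdifs R d G) (w : seq (edge G)) : 'rV[R]_d -> 'rV[R]_d :=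
  foldr (fun e g => S e \o g) id w.

Definition is_attractor (R : realType) (d n : nat) (G : digraph n)
    (S : gdifs R d G) (A : 'I_n -> set 'rV[R]_d) : Prop :=
  (forall i, A i !=set0 /\ compact (A i)) /\
  (forall i, A i =
     \bigcup_(k in [set: 'I_n]) \bigcup_(e in edges_between i k) (S e @` A k)).

(* Disjointness is that of the family indexed by the edges leaving i: two
   distinct edges with the same image violate the condition. *)
Definition strong_separation (R : realType) (d n : nat) (G : digraph n)
    (S : gdifs R d G) (A : 'I_n -> set 'rV[R]_d) : Prop :=
  forall i : 'I_n,
    trivIset [set e : edge G | src e = i] (fun e => S e @` A (tgt e)).

Definition bounded_distortion (R : realType) (d n : nat) (G : digraph n)
    (S : gdifs R d G) : Prop :=
  exists2 K : R, 0 < K &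
    forall w : seq (edge G), admissible w ->
      (LipP (gdifs_path S w) <= K%:E * LipM (gdifs_path S w))%E.

(* Main.v *)
Require Import Defs.
From mathcomp Require Import all_boot all_order all_algebra.
From mathcomp Require Import all_classical all_reals all_analysis.

Set Implicit Arguments.
Unset Strict Implicit.
Unset Printing Implicit Defensive.
Import Order.TTheory GRing.Theory Num.Theory.
Import numFieldNormedType.Exports.
Local Open Scope classical_set_scope.
Local Open Scope ring_scope.

(** Every point of [A i] has an address: an infinite path of edges leaving [i]
whose successive cylinders [S_w (A j)] all contain it, and similarly for
[B i].  Sending a point of [A i] to the point of [B i] with the same address
is the required map.

It is bi-Lipschitz for the following reason.  Let [x], [x'] have addresses
that agree on a finite path [p] and split afterwards, and let [y], [y'] be the
points of [B i] with these addresses.  Then [x = S_p u] and [x' = S_p u'],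
where [u] and [u'] lie in images of the attractor under two distinct edges
leaving the same vertex, so that strong separation and compactness give
[r <= |u - u'|] with [r > 0] independent of the points.  Also [y = T_p v] and
[y' = T_p v'] with [|v - v'| <= D], where [D] bounds the diameters of the [B j].
Bounded distortion and equality of the Lipschitz constants give
[Lip+ (T_p) <= K Lip- (S_p)], hence
[|y - y'| <= Lip+ (T_p) D <= K Lip- (S_p) D <= (K D / r) |x - x'|].
The roles of the two systems can be exchanged, because equality of the
constants also gives [Lip+ (S_p) <= K Lip- (T_p)].

Infinite addresses are replaced by the relation [same_code], which asks for
common cylinders of every finite length: [same_code_total] shows that every
point has a partner, [same_code_lipschitz] is the estimate above, and used in
both directions the latter implies that the relation is the graph of a
bijection. *)

(** * Euclidean norm and Lipschitz constants *)

Lemma normr_le_enorm (R : realType) (d : nat) (x : 'rV[R]_d) :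
  `|x| <= enorm x.
Proof.
rewrite [leLHS]mx_normrE; apply/bigmax_leP; split=> [|[i j] _] /=.
  exact: sqrtr_ge0.
rewrite (ord1 i) -sqrtr_sqr; apply: ler_wsqrtr.
by rewrite (bigD1 j) //= lerDl sumr_ge0 // => k _; rewrite sqr_ge0.
Qed.

Lemma enorm_le_normr (R : realType) (d : nat) (x : 'rV[R]_d) :
  enorm x <= Num.sqrt d%:R * `|x|.
Proof.
rewrite -[`|x|]ger0_norm // -sqrtr_sqr -sqrtrM ?ler0n //.
apply: ler_wsqrtr; rewrite mulr_natl -[X in _ *+ X]card_ord -sumr_const.
apply: ler_sum => j _; rewrite -real_normK ?num_real //.
apply: lerXn2r; rewrite ?nnegrE //.
rewrite [leRHS]mx_normrE.
exact: (@le_bigmax_cond _ _ _ _ (ord0, j) xpredT (fun ij => `|x ij.1 ij.2|)).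
Qed.

Lemma enorm0 (R : realType) (d : nat) : enorm (0 : 'rV[R]_d) = 0.
Proof. by rewrite /enorm big1 ?sqrtr0 // => i _; rewrite mxE expr0n. Qed.

Lemma enorm_eq0 (R : realType) (d : nat) (x : 'rV[R]_d) :
  (enorm x == 0) = (x == 0).
Proof.
apply/eqP/eqP => [x0|->]; last exact: enorm0.
by apply/eqP; rewrite -normr_le0 -x0 normr_le_enorm.
Qed.

Lemma enorm_gt0 (R : realType) (d : nat) (x y : 'rV[R]_d) :
  x <> y -> 0 < enorm (x - y).
Proof.
by move=> /eqP xy; rewrite lt_def sqrtr_ge0 enorm_eq0 subr_eq0 xy.
Qed.

Lemma LipP_bound (R : realType) (d : nat) (f : 'rV[R]_d -> 'rV[R]_d) (c : R) :
  (LipP f <= c%:E)%E -> forall x y, enorm (f x - f y) <= c * enorm (x - y).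
Proof.
move=> fc x y; have [->|xy] := pselect (x = y).
  by rewrite !subrr enorm0 mulr0.
rewrite -ler_pdivrMr ?enorm_gt0 // -lee_fin; apply: le_trans fc.
by apply: ereal_sup_ubound; exists x, y.
Qed.

(** A comparison of the extended-real constants of two maps gives a comparison
of their difference quotients at arbitrary pairs of points, in real numbers.
It is stated without division so that coinciding points are no exception. *)
Lemma distortion_bound (R : realType) (d : nat)
    (f g : 'rV[R]_d -> 'rV[R]_d) (K : R) : 0 <= K ->
  (LipP g <= K%:E * LipM f)%E -> forall u u' v v',
  enorm (g v - g v') * enorm (u - u') <=
    K * enorm (f u - f u') * enorm (v - v').
Proof.
move=> K0 gf u u' v v'.
have [->|uu'] := pselect (u = u').
  by rewrite !(subrr, enorm0, mulr0, mul0r).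
have [->|vv'] := pselect (v = v').
  by rewrite !(subrr, enorm0, mulr0, mul0r).
rewrite -ler_pdivrMr ?enorm_gt0 // -mulrAC -ler_pdivlMr ?enorm_gt0 // -mulrA.
rewrite -lee_fin [leRHS]EFinM.
have gv : ((enorm (g v - g v') / enorm (v - v'))%:E <= LipP g)%E.
  by apply: ereal_sup_ubound; exists v, v'.
apply: le_trans gv (le_trans gf _).
apply: lee_wpmul2l; first by rewrite lee_fin.
by apply: ereal_inf_lbound; exists u, u'.
Qed.

(** The topology is that of the sup norm while the constants are Euclidean:
passing from one norm to the other costs the factor [Num.sqrt d%:R], to which
1 is added below to keep the divisor positive in dimension 0. *)
Lemma LipP_lt1_continuous (R : realType) (d : nat) (f : 'rV[R]_d -> 'rV[R]_d) :
  (LipP f < 1)%E -> continuous f.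
Proof.
move=> f1 x; have fL := LipP_bound (ltW f1).
apply: (@cvgrPdist_lt _ _ _ _ (nbhs_filter x) f (f x)).2 => e e0.
have k0 : 0 < Num.sqrt d%:R + 1 :> R by rewrite ltr_wpDl ?sqrtr_ge0.
near=> y.
apply: le_lt_trans (normr_le_enorm _) _; apply: le_lt_trans (fL _ _) _.
rewrite mul1r; apply: le_lt_trans (enorm_le_normr _) _.
apply: (@le_lt_trans _ _ ((Num.sqrt d%:R + 1) * `|x - y|)).
  by rewrite ler_wpM2r // lerDl.
rewrite mulrC -ltr_pdivlMr //; near: y.
by apply: cvgr_dist_lt => //; exact: divr_gt0.
Unshelve. all: by end_near. Qed.

(** * Compact sets *)

(** The sup-norm distances between points of the two sets form a compact, hence closed,
set of reals that misses 0.  The conclusion is phrased with a filter so that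
finitely many gaps can be combined into one. *)
Lemma compact_gap (R : realType) (d : nat) (K L : set 'rV[R]_d) :
  compact K -> compact L -> K `&` L = set0 ->
  \forall r \near 0^'+, forall u v, K u -> L v -> r <= enorm (u - v).
Proof.
move=> cK cL KL.
pose D := (fun p : 'rV[R]_d * 'rV[R]_d => `|p.1 - p.2|) @` (K `*` L).
have cD : compact D.
  apply: continuous_compact; last exact: compact_setX.
  apply: continuous_subspaceT => p.
  apply: cvg_norm; apply: cvgB; [exact: cvg_fst|exact: cvg_snd].
have D0 : ~ D 0.
  move=> [[u v] [/= Ku Lv] /eqP]; rewrite normr_eq0 subr_eq0 => /eqP uv.
  have : (K `&` L) u by split=> //; rewrite uv.
  by rewrite KL.
have : nbhs (0 : R) (~` D).
  apply: open_nbhs_nbhs; split=> //; apply: closed_openC.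
  by apply: compact_closed => //; exact: Rhausdorff.
move=> /nbhs_ballP[e /= e0 eD].
near=> r => u v Ku Lv; apply: le_trans (normr_le_enorm _).
rewrite leNgt; apply/negP => uvr.
apply: (eD `|u - v|); last by exists (u, v).
rewrite /ball /= sub0r normrN normr_id; apply: lt_trans uvr _.
by near: r; exact: nbhs_right_lt.
Unshelve. all: by end_near. Qed.

(** A cluster point of any sequence with [m]-th term in [K m] lies in every
[K m], since the sequence is eventually in this closed set. *)
Lemma nested_compact_nonempty (T : topologicalType) (K : nat -> set T) :
  hausdorff_space T -> (forall m, compact (K m)) -> (forall m, K m !=set0) ->
  (forall m, K m.+1 `<=` K m) -> exists x, forall m, K m x.
Proof.
move=> hT cK K0 Kd.
have Kle m k : (m <= k)%N -> K k `<=` K m.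
  move=> /subnKC <-; elim: (k - m)%N => [|j IH]; first by rewrite addn0.
  by rewrite addnS; apply: subset_trans IH; exact: Kd.
have [y yK] := choice K0.
have yev m : (y @ \oo) (K m).
  by exists m => // k /= mk; exact: Kle (yK k).
have [x [_ xy]] := cK 0%N _ _ (yev 0%N).
exists x => m; apply: (compact_closed hT (cK m)) => B xB.
exact: xy.
Qed.

(** * Cylinders of an attractor *)

Lemma attractor_mem (R : realType) (d n : nat) (G : digraph n)
    (S : gdifs R d G) (A : 'I_n -> set 'rV[R]_d) (i : 'I_n) (x : 'rV[R]_d) :
  is_attractor S A ->
  A i x <-> exists e : edge G, src e = i /\ (S e @` A (tgt e)) x.
Proof.
move=> [_ ->]; split=> [[k _ [e [<- <-] ?]]|[e [ei xe]]]; first by exists e.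
by exists (tgt e) => //; exists e.
Qed.

(** When [w] is a path leaving [i] and ending at [j], this is the set
[S_w (A j)]; it is empty for any other nonempty [w].  Recursion on the path,
rather than composition of maps, builds admissibility into membership. *)
Fixpoint cylinder (R : realType) (d n : nat) (G : digraph n)
    (S : gdifs R d G) (A : 'I_n -> set 'rV[R]_d) (i : 'I_n)
    (w : seq (edge G)) : set 'rV[R]_d :=
  if w is e :: w' then
    [set x | src e = i /\ (S e @` cylinder S A (tgt e) w') x]
  else A i.

Lemma cylinder_sub (R : realType) (d n : nat) (G : digraph n)
    (S : gdifs R d G) (A : 'I_n -> set 'rV[R]_d) (w : seq (edge G))
    (i : 'I_n) : is_attractor S A -> cylinder S A i w `<=` A i.
Proof.
move=> hA; elim: w i => [i x|e w IH i x] /=; first by [].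
move=> [ei [u uw ux]].
by apply/(attractor_mem _ _ hA); exists e; split=> //; exists u => //; exact: IH.
Qed.

Lemma cylinder_compact (R : realType) (d n : nat) (G : digraph n)
    (S : gdifs R d G) (A : 'I_n -> set 'rV[R]_d) (w : seq (edge G))
    (i : 'I_n) : is_attractor S A -> compact (cylinder S A i w).
Proof.
move=> hA; elim: w i => [|e w IH] i /=; first exact: (hA.1 i).2.
have [ei|ei] := pselect (src e = i).
  have -> : [set x | src e = i /\ (S e @` cylinder S A (tgt e) w) x] =
      S e @` cylinder S A (tgt e) w.
    by apply/seteqP; split=> x => [[]|].
  apply: continuous_compact (IH _); apply: continuous_subspaceT.
  exact: LipP_lt1_continuous (gdifs_contraction _ _).
have -> : [set x | src e = i /\ (S e @` cylinder S A (tgt e) w) x] = set0.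
  by apply/seteqP; split=> x => [[]|].
exact: compact0.
Qed.

(** The vertex reached after [p] depends only on [i] and [p]: points of both
systems with a common prefix [p] are thus pulled back to the same vertex. *)
Lemma cylinder_cat (R : realType) (d n : nat) (G : digraph n)
    (S : gdifs R d G) (A : 'I_n -> set 'rV[R]_d) (p q : seq (edge G))
    (i : 'I_n) :
  cylinder S A i (p ++ q) `<=`
    gdifs_path S p @` cylinder S A (last i (map (@tgt _ G) p)) q.
Proof.
elim: p i => [|e p IH] i x /= => [xq|]; first by exists x.
by move=> [_ [_ /IH[u uq <-] <-]]; exists u.
Qed.

Lemma cylinder_admissible (R : realType) (d n : nat) (G : digraph n)
    (S : gdifs R d G) (A : 'I_n -> set 'rV[R]_d) (p q : seq (edge G))
    (i : 'I_n) (x : 'rV[R]_d) :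
  cylinder S A i (p ++ q) x -> p != [::] -> admissible p.
Proof.
case: p => [//|e p] /= [_ [u up _]] _; rewrite /admissible /=.
elim: p e u up {x i} => [//|e' p IH] e u /= [-> [v vp _]].
by rewrite eqxx (IH _ v).
Qed.

Lemma cylinder_diam (R : realType) (d n : nat) (G : digraph n)
    (S : gdifs R d G) (A : 'I_n -> set 'rV[R]_d) (c D : R) : 0 <= c ->
  (forall e : edge G, (LipP (S e) <= c%:E)%E) ->
  (forall i u v, A i u -> A i v -> enorm (u - v) <= D) ->
  forall w i x y, cylinder S A i w x -> cylinder S A i w y ->
    enorm (x - y) <= c ^+ size w * D.
Proof.
move=> c0 Sc AD; elim=> [|e w IH] i x y /=.
  by rewrite expr0 mul1r; exact: AD.
move=> [_ [u uw <-]] [_ [v vw <-]].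
apply: le_trans (LipP_bound (Sc e) u v) _.
by rewrite exprS -mulrA ler_wpM2l // (IH (tgt e)).
Qed.

(** * Constants uniform over the vertices and edges *)

Lemma attractor_bounded (R : realType) (d n : nat) (G : digraph n)
    (S : gdifs R d G) (A : 'I_n -> set 'rV[R]_d) : is_attractor S A ->
  exists2 D : R, 0 <= D &
    forall i u v, A i u -> A i v -> enorm (u - v) <= D.
Proof.
move=> [hA _].
have [M [M0 AM]] : exists M : R, 0 <= M /\ forall i u, A i u -> `|u| <= M.
  apply: (@filter_ex _ (+oo : set_system R)); near=> M; split.
    by near: M; exact: nbhs_pinfty_ge.
  near: M; apply: filter_forall => i.
  exact: compact_bounded (hA i).2.
exists (Num.sqrt d%:R * (M + M)) => [|i u v Au Av].
  by rewrite mulr_ge0 ?sqrtr_ge0 ?addr_ge0.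
apply: le_trans (enorm_le_normr _) _; rewrite ler_wpM2l ?sqrtr_ge0 //.
by apply: le_trans (ler_normB _ _) _; rewrite lerD // (AM i).
Unshelve. all: by end_near. Qed.

Lemma uniform_contraction (R : realType) (d n : nat) (G : digraph n)
    (S : gdifs R d G) :
  exists c : R, [/\ 0 <= c, c < 1 & forall e : edge G, (LipP (S e) <= c%:E)%E].
Proof.
suff [c [[c0 c1] Sc]] : exists c : R, (0 <= c /\ c < 1) /\
    forall e : edge G, (LipP (S e) <= c%:E)%E by exists c.
apply: (@filter_ex _ (1^'- : set_system R)); near=> c; split; first split.
- by near: c; exact: nbhs_left_ge.
- by near: c; exact: nbhs_left_lt.
near: c; apply: filter_forall => e.
have := gdifs_contraction S e; case: (LipP (S e)) => [r||] //.
  by rewrite lte_fin => r1; near=> c; rewrite lee_fin; near: c; exact: nbhs_left_ge.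
by move=> _; near=> c; rewrite leNye.
Unshelve. all: by end_near. Qed.

Lemma separation_gap (R : realType) (d n : nat) (G : digraph n)
    (S : gdifs R d G) (A : 'I_n -> set 'rV[R]_d) :
  is_attractor S A -> strong_separation S A ->
  exists2 r : R, 0 < r & forall (e e' : edge G) u v,
    src e = src e' -> e <> e' -> A (tgt e) u -> A (tgt e') v ->
    r <= enorm (S e u - S e' v).
Proof.
move=> [hA _] ssc.
have cS e : compact (S e @` A (tgt e)).
  apply: continuous_compact (hA _).2; apply: continuous_subspaceT.
  exact: LipP_lt1_continuous (gdifs_contraction _ _).
suff [r [r0 rS]] : exists r : R, 0 < r /\ forall e e' : edge G,
    src e = src e' -> e <> e' -> forall x y,
    (S e @` A (tgt e)) x -> (S e' @` A (tgt e')) y -> r <= enorm (x - y).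
  exists r => // e e' u v ee' ne Au Av.
  exact: (rS e e').
apply: (@filter_ex _ (0^'+ : set_system R)); near=> r; split=> //.
near: r; apply: filter_forall => e; apply: filter_forall => e'.
have [[ee' ne]|Nee] := pselect (src e = src e' /\ e <> e'); last first.
  by near=> r => ee' ne; case: Nee.
have disj : S e @` A (tgt e) `&` S e' @` A (tgt e') = set0.
  apply/eqP; apply: contrapT => /negP/set0P hx; apply: ne.
  exact: (ssc (src e)).
have := compact_gap (cS e) (cS e') disj.
by apply: filterS => r rS _ _ x y; exact: rS.
Unshelve. all: by end_near. Qed.

(** * Points with a common address *)

(** One path for each length [m], rather than one infinite path: the estimate
below looks at a single length at a time, and [m = 0] says that [x] and [y]
lie in [A i] and [B i]. *)
Definition same_code (R : realType) (d n : nat) (G : digraph n)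
    (S T : gdifs R d G) (A B : 'I_n -> set 'rV[R]_d) (i : 'I_n)
    (x y : 'rV[R]_d) : Prop :=
  forall m : nat, exists w : seq (edge G),
    [/\ size w = m, cylinder S A i w x & cylinder T B i w y].

Lemma same_code_sym (R : realType) (d n : nat) (G : digraph n)
    (S T : gdifs R d G) (A B : 'I_n -> set 'rV[R]_d) (i : 'I_n)
    (x y : 'rV[R]_d) :
  same_code S T A B i x y -> same_code T S B A i y x.
Proof. by move=> h m; have [w [? ? ?]] := h m; exists w. Qed.

(** Choosing, for each point of the attractor, a first edge and a preimage under
it defines a shift map; iterating it from [x] produces an address of [x].  The
cylinders of [T] along this address are nested nonempty compact sets, and a
common point of them is the partner of [x]. *)
Lemma same_code_total (R : realType) (d n : nat) (G : digraph n)
    (S T : gdifs R d G) (A B : 'I_n -> set 'rV[R]_d) (i : 'I_n)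
    (x : 'rV[R]_d) :
  is_attractor S A -> is_attractor T B -> A i x ->
  exists y, same_code S T A B i x y.
Proof.
move=> hA hB Ax.
have step (s : 'I_n * 'rV[R]_d) : exists q : edge G * 'rV[R]_d,
    A s.1 s.2 -> [/\ src q.1 = s.1, A (tgt q.1) q.2 & S q.1 q.2 = s.2].
  have [As|nAs] := pselect (A s.1 s.2).
    by have [e [ei [u Au us]]] := (attractor_mem _ _ hA).1 As; exists (e, u).
  by have [e _] := gdifs_out S s.1; exists (e, 0).
have {step}[f fP] := choice step.
pose next s : 'I_n * 'rV[R]_d := (tgt (f s).1, (f s).2).
pose code m s := [seq (f t).1 | t <- traject next s m].
have code_size m s : size (code m s) = m.
  by rewrite size_map size_traject.
have code_mem m s : A s.1 s.2 -> cylinder S A s.1 (code m s) s.2.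
  elim: m s => //= m IH s As; have [fs1 fs2 fs3] := fP s As.
  by split=> //; exists (f s).2 => //; exact: (IH (next s)).
have code_nonempty m s : A s.1 s.2 -> cylinder T B s.1 (code m s) !=set0.
  elim: m s => [|m IH] s As /=; first exact: (hB.1 s.1).1.
  have [fs1 fs2 fs3] := fP s As; have [y hy] := IH (next s) fs2.
  by exists (T (f s).1 y); split=> //; exists y.
have code_nested m s :
    cylinder T B s.1 (code m.+1 s) `<=` cylinder T B s.1 (code m s).
  elim: m s => [|m IH] s y /=.
    by move=> [<- hy]; apply/(attractor_mem _ _ hB); exists (f s).1.
  by move=> [? [v hv <-]]; split=> //; exists v => //; exact: (IH (next s)).
have [y hy] : exists y, forall m, cylinder T B i (code m (i, x)) y.
  apply: nested_compact_nonempty => [|m|m|m].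
  - exact: norm_hausdorff.
  - exact: cylinder_compact.
  - exact: (code_nonempty m (i, x)).
  - exact: (code_nested m (i, x)).
exists y => m; exists (code m (i, x)); split=> //.
exact: (code_mem m (i, x)).
Qed.

Lemma first_difference (X : eqType) (w w' : seq X) : size w = size w' ->
  w <> w' -> exists p e e' q q',
    [/\ w = p ++ e :: q, w' = p ++ e' :: q' & e <> e'].
Proof.
elim: w w' => [|e w IH] [|e' w'] //= [sw] ne.
have [ee'|ee'] := eqVneq e e'; last first.
  by exists [::], e, e', w, w'; split=> //; exact/eqP.
have [|p [f [f' [q [q' [-> -> ff']]]]]] := IH w' sw.
  by move=> ww'; apply: ne; rewrite ee' ww'.
by exists (e :: p), f, f', q, q'; split; rewrite // ee'.
Qed.

(** If [m] is so large that cylinders of length [m] in [B] have diameter below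
[|y - y'|], then the paths of length [m] for [y] and [y'] must differ.  They
are compared at the first difference: separation in [A] bounds [|x - x'|] from
below, the diameters in [B] bound [|y - y'|] from above. *)
Lemma same_code_lipschitz (R : realType) (d n : nat) (G : digraph n)
    (S T : gdifs R d G) (A B : 'I_n -> set 'rV[R]_d) (K : R) :
  is_attractor S A -> is_attractor T B -> strong_separation S A -> 0 <= K ->
  (forall w, admissible w ->
    (LipP (gdifs_path T w) <= K%:E * LipM (gdifs_path S w))%E) ->
  exists2 C : R, 1 <= C & forall i x y x' y',
    same_code S T A B i x y -> same_code S T A B i x' y' ->
    enorm (y - y') <= C * enorm (x - x').
Proof.
move=> hA hB sscS K0 dist.
have [r r0 gap] := separation_gap hA sscS.
have [D D0 BD] := attractor_bounded hB.
have [c [c0 c1 Tc]] := uniform_contraction T.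
(* The empty common prefix is not an admissible path, so the distortion
   hypothesis does not cover it: the identity map needs a constant >= 1. *)
pose K1 := Num.max K 1.
have K10 : 0 <= K1 by rewrite le_max K0.
exists (Num.max (K1 * D / r) 1); first by rewrite le_max lexx orbT.
move=> i x y x' y' xy xy'.
have [->|yy'] := pselect (y = y').
  by rewrite subrr enorm0 mulr_ge0 ?sqrtr_ge0 // le_max ler01 orbT.
have [m hm] : exists m, c ^+ m * D < enorm (y - y').
  have /cvgrPdist_lt : (fun m => c ^+ m * D) @ \oo --> 0.
    rewrite -[X in _ --> X](mul0r D); apply: cvgMl.
    by apply: cvg_expr; rewrite ger0_norm.
  move=> /(_ _ (enorm_gt0 yy'))[m _ /(_ m (leqnn m))] /=.
  by rewrite sub0r normrN ger0_norm ?mulr_ge0 ?exprn_ge0 // => ?; exists m.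
have [w [sw xw yw]] := xy m; have [w' [sw' xw' yw']] := xy' m.
have ww' : w <> w'.
  move=> ww'; subst w'; have := cylinder_diam c0 Tc BD yw yw'.
  by rewrite sw leNgt hm.
have [|p [e [e' [q [q' [ew ew' ee']]]]]] := first_difference _ ww'.
  by rewrite sw sw'.
subst w w'; have padm := cylinder_admissible xw.
move: xw xw' yw yw' => /cylinder_cat[u /= [ei [a Aa <-]] <-].
move=> /cylinder_cat[u' /= [e'i [a' Aa' <-]] <-].
move=> /cylinder_cat[v /(cylinder_sub hB) vB <-].
move=> /cylinder_cat[v' /(cylinder_sub hB) vB' <-].
have hr : r <= enorm (S e a - S e' a').
  apply: gap => //; first by rewrite ei e'i.
    exact: cylinder_sub Aa.
  exact: cylinder_sub Aa'.
have := BD _ _ _ vB vB'.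
move: (S e a) (S e' a') hr => b b' hr vD.
have key : enorm (gdifs_path T p v - gdifs_path T p v') * enorm (b - b') <=
    K1 * enorm (gdifs_path S p b - gdifs_path S p b') * enorm (v - v').
  have [->|p0] := eqVneq p [::].
    rewrite /= -mulrA [_ * enorm (v - v')]mulrC ler_peMl //.
      by rewrite mulr_ge0 ?sqrtr_ge0.
    by rewrite le_max lexx orbT.
  apply: le_trans (distortion_bound K0 (dist p (padm p0)) b b' v v') _.
  by rewrite -!mulrA ler_wpM2r ?mulr_ge0 ?sqrtr_ge0 // le_max lexx.
apply: (@le_trans _ _ (K1 * D / r * enorm
    (gdifs_path S p b - gdifs_path S p b'))); last first.
  by rewrite ler_wpM2r ?sqrtr_ge0 // le_max lexx.
rewrite mulrAC ler_pdivlMr // [K1 * D * _]mulrAC.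
apply: le_trans (ler_wpM2l _ hr) _; first exact: sqrtr_ge0.
by apply: le_trans key _; rewrite ler_wpM2l // mulr_ge0 ?sqrtr_ge0.
Qed.

Theorem theorem2p5 (R : realType) (d n : nat) (G : digraph n)
    (S T : gdifs R d G) (A B : 'I_n -> set 'rV[R]_d)
    (hG : strongly_connected G)
    (hA : is_attractor S A) (hB : is_attractor T B)
    (hS : forall e : edge G, bi_lipschitz (S e))
    (hT : forall e : edge G, bi_lipschitz (T e))
    (sscS : strong_separation S A) (sscT : strong_separation T B)
    (bdpS : bounded_distortion S)
    (hLipM : forall w : seq (edge G), admissible w ->
       LipM (gdifs_path S w) = LipM (gdifs_path T w))
    (hLipP : forall w : seq (edge G), admissible w ->
       LipP (gdifs_path S w) = LipP (gdifs_path T w)) :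
  forall i : 'I_n, bi_lipschitz_equivalent (A i) (B i).
Proof.
move=> i; have [K K0 SK] := bdpS.
have [C C1 ST] : exists2 C : R, 1 <= C & forall i x y x' y',
    same_code S T A B i x y -> same_code S T A B i x' y' ->
    enorm (y - y') <= C * enorm (x - x').
  apply: (same_code_lipschitz hA hB sscS (ltW K0)) => w hw.
  by rewrite -hLipP // SK.
have [C' C'1 TS] : exists2 C : R, 1 <= C & forall i y x y' x',
    same_code T S B A i y x -> same_code T S B A i y' x' ->
    enorm (x - x') <= C * enorm (y - y').
  apply: (same_code_lipschitz hB hA sscT (ltW K0)) => w hw.
  by rewrite -hLipM // SK.
have partner x : exists y, A i x -> same_code S T A B i x y.
  have [Ax|nAx] := pselect (A i x); last by exists 0.
  by have [y xy] := same_code_total hA hB Ax; exists y.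
have {partner}[Phi PhiP] := choice partner.
have enorm_le0 (u v : 'rV[R]_d) : enorm (u - v) <= 0 -> u = v.
  move=> uv; apply/eqP; rewrite -subr_eq0 -enorm_eq0.
  by rewrite eq_le uv sqrtr_ge0.
exists Phi, (Num.max C C'); split.
- split.
  + move=> x Ax /=; have [w [_ _]] := PhiP x Ax 0%N.
    exact: cylinder_sub.
  + move=> x x' /set_mem Ax /set_mem Ax' xx'; apply: enorm_le0.
    have := TS _ _ _ _ _ (same_code_sym (PhiP x Ax))
      (same_code_sym (PhiP x' Ax')).
    by rewrite xx' subrr enorm0 mulr0.
  + move=> y By; have [x yx] := same_code_total hB hA By.
    have Ax : A i x by have [w [_ _]] := yx 0%N; exact: cylinder_sub.
    exists x => //; apply: enorm_le0.
    have := ST _ _ _ _ _ (PhiP x Ax) (same_code_sym yx).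
    by rewrite subrr enorm0 mulr0.
- by rewrite le_max C1.
move=> x x' Ax Ax'; apply/andP; split.
  rewrite ler_pdivrMl; last by rewrite lt_max (lt_le_trans ltr01 C1).
  apply: le_trans (TS _ _ _ _ _ (same_code_sym (PhiP x Ax))
    (same_code_sym (PhiP x' Ax'))) _.
  by rewrite ler_wpM2r ?sqrtr_ge0 // le_max lexx orbT.
apply: le_trans (ST _ _ _ _ _ (PhiP x Ax) (PhiP x' Ax')) _.
by rewrite ler_wpM2r ?sqrtr_ge0 // le_max lexx.
Qed.
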